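(* Let $G$ be a graph and $v\in V(G)$. Then $v$ is a shedding vertex of $G$ if and only if $\varepsilon_{G-v}(A)=\varepsilon_G(A)$ for every independent set $A$ of $G-v$.
   Context: Graphs are finite, simple, undirected. $\mathrm{Ind}(G)$ is the family of independent sets (sets of pairwise non-adjacent vertices) of $G$. For $A\in\mathrm{Ind}(G)$, $\varepsilon_G(A)=\max\{|S|: A\subseteq S,\ S\in\mathrm{Ind}(G)\}$. $N(v)$ is the neighborhood of $v$, $N[v]=N(v)\cup\{v\}$, and for $U\subseteq V(G)$, $G-U$ is the subgraph induced by $V(G)\setminus U$; $G-v=G-\{v\}$. A vertex $v$ is a shedding vertex of $G$ if for every independent set $S$ of $G-N[v]$ there exists $u\in N(v)$ such that $S\cup\{u\}$ is independent. *)

(* Defs.v *)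
From mathcomp Require Import all_boot.

Set Implicit Arguments.
Unset Strict Implicit.
Unset Printing Implicit Defensive.

(* The vertex set is a subset of an ambient finType, so that independent sets
   of an induced subgraph and of the graph itself live in the same {set T}. *)
Record sgraph (T : finType) := SGraph {
  vset : {set T};
  adj : rel T;
  adj_sym : symmetric adj;
  adj_irr : irreflexive adj;
  adj_vset : forall x y, adj x y -> x \in vset
}.

Section Graphs.

Variables (T : finType) (G : sgraph T).
Implicit Types (A S U : {set T}) (v : T).

Definition nbh v : {set T} := [set u | adj G v u].

Definition cl_nbh v : {set T} := v |: nbh v.

Definition del_adj U : rel T :=
  fun x y => [&& adj G x y, x \notin U & y \notin U].

Fact del_adj_sym U : symmetric (del_adj U).
Proof. by move=> x y; rewrite /del_adj adj_sym [(x \notin U) && _]andbC. Qed.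

Fact del_adj_irr U : irreflexive (del_adj U).
Proof. by move=> x; rewrite /del_adj adj_irr. Qed.

Fact del_adj_vset U x y : del_adj U x y -> x \in vset G :\: U.
Proof. by case/and3P=> /adj_vset xV xU _; rewrite inE xU. Qed.

Definition del U : sgraph T :=
  SGraph (@del_adj_sym U) (@del_adj_irr U) (@del_adj_vset U).

Definition Ind : {set {set T}} :=
  [set S : {set T} | (S \subset vset G)
    && [forall x in S, forall y in S, (x != y) ==> ~~ adj G x y]].

(* Meaningful for A \in Ind only; the value is 0 otherwise. *)
Definition eps A : nat := \max_(S in Ind | A \subset S) #|S|.

End Graphs.

Definition shedding (T : finType) (G : sgraph T) (v : T) : Prop :=
  forall S : {set T}, S \in Ind (del G (cl_nbh G v)) ->
    exists2 u, u \in nbh G v & S :|: [set u] \in Ind G.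

(* Main.v *)
Require Import Defs.
From mathcomp Require Import all_boot.

Set Implicit Arguments.
Unset Strict Implicit.
Unset Printing Implicit Defensive.

(** If [v] is shedding, an independent set containing [v] can trade [v] for one
    of its neighbours, so a maximum extension of [A] can be found avoiding [v].
    Conversely, let [M] be a maximum extension of [S] in [G - v].  If [M] missed
    [N(v)], then [v |: M] would be a larger extension of [S] in [G]; hence [M]
    contains a neighbour of [v], which can be added to [S]. *)

Lemma IndP (T : finType) (G : sgraph T) (S : {set T}) :
  reflect (S \subset vset G /\ {in S &, forall x y, ~~ adj G x y})
          (S \in Ind G).
Proof.
rewrite inE; apply: (iffP andP) => -[SV indS]; split=> //.
  move=> x y xS yS; have [<-|neq_xy] := eqVneq x y; first by rewrite adj_irr.
  by have /forall_inP/(_ y yS)/implyP := forall_inP indS x xS; apply.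
by apply/forall_inP=> x xS; apply/forall_inP=> y yS; rewrite indS ?implybT.
Qed.

Lemma Ind_subset (T : finType) (G : sgraph T) (A B : {set T}) :
  A \subset B -> B \in Ind G -> A \in Ind G.
Proof.
move=> AB /IndP[BV indB]; apply/IndP; split; first exact: subset_trans BV.
by move=> x y /(subsetP AB) xB /(subsetP AB) yB; apply: indB.
Qed.

(** Outside [U] the relations [del_adj U] and [adj G] agree. This lets both values of [eps] in the
    theorem be compared through independent sets of [G] itself. *)
Lemma Ind_del (T : finType) (G : sgraph T) (U S : {set T}) :
  (S \in Ind (del G U)) = (S \in Ind G) && [disjoint S & U].
Proof.
apply/IndP/andP => /= [[] | [/IndP[SV indS] dSU]]; last first.
  split; first by rewrite subsetD SV.
  by move=> x y xS yS; rewrite /del_adj (negPf (indS x y xS yS)).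
rewrite subsetD => /andP[SV dSU] indS; split=> //; apply/IndP; split=> //.
move=> x y xS yS; have := indS x y xS yS.
by rewrite /del_adj !(disjointFr dSU) //= !andbT.
Qed.

Lemma IndU1 (T : finType) (G : sgraph T) (v : T) (S : {set T}) :
  v \in vset G -> S \in Ind G -> [disjoint S & nbh G v] -> v |: S \in Ind G.
Proof.
move=> vV /IndP[SV indS] dSv; apply/IndP; split; first by rewrite subUset sub1set vV.
have nadj x : x \in S -> ~~ adj G v x.
  by move=> xS; have := disjointFr dSv xS; rewrite inE => ->.
move=> x y /setU1P[->|xS] /setU1P[->|yS].
- by rewrite adj_irr.
- exact: nadj.
- by rewrite adj_sym nadj.
- exact: indS.
Qed.

Lemma leq_eps (T : finType) (G : sgraph T) (A S : {set T}) :
  S \in Ind G -> A \subset S -> #|S| <= eps G A.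
Proof.
by move=> indS AS; rewrite /eps (leq_bigmax_cond S (F := fun S : {set T} => #|S|)) ?indS.
Qed.

(** [A] extends itself, so the maximum ranges over a nonempty family and is not the default 0. *)
Lemma eps_attained (T : finType) (G : sgraph T) (A : {set T}) :
  A \in Ind G -> exists2 S, S \in Ind G /\ A \subset S & eps G A = #|S|.
Proof.
move=> indA.
have [|S /andP[indS AS] epsS] := @eq_bigmax_cond _
  [pred S : {set T} | (S \in Ind G) && (A \subset S)] (fun S : {set T} => #|S|).
  by apply/card_gt0P; exists A; rewrite inE indA /=.
by exists S.
Qed.

Theorem theorem3p2 (T : finType) (G : sgraph T) (v : T) (hv : v \in vset G) :
  shedding G v <->
  (forall A : {set T}, A \in Ind (del G [set v]) ->
     eps (del G [set v]) A = eps G A).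
Proof.
split=> [shed A indA | eps_eq S].
  have [indGA vA] : A \in Ind G /\ v \notin A.
    by move: indA; rewrite Ind_del disjoint_sym disjoints1 => /andP.
  apply/eqP; rewrite eqn_leq; apply/andP; split.
    have [S [indS AS] ->] := eps_attained indA.
    by apply: leq_eps AS; move: indS; rewrite Ind_del => /andP[].
  have [S [indS AS] ->] := eps_attained indGA.
  (* If [v] is not in [S], then [S] already competes in [G - v]. *)
  have [vS|vS] := boolP (v \in S); last first.
    by apply: leq_eps AS; rewrite Ind_del indS disjoint_sym disjoints1.
  have /IndP[_ nadjS] := indS.
  (* As [v] lies in the independent set [S], the rest of [S] avoids [N[v]]. *)
  have [|u uv indu] := shed (S :\ v).
    rewrite Ind_del (Ind_subset (subD1set S v) indS) disjoints_subset.
    apply/subsetP=> x /setD1P[xv xS].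
    by rewrite !inE negb_or xv nadjS.
  (* A neighbour of [v] cannot lie in [S] beside [v], so trading [v] for [u] keeps the
     cardinality. *)
  have uS : u \notin S.
    by apply/negP=> uS; move: uv; rewrite inE (negPf (nadjS _ _ vS uS)).
  have vu : v != u by apply: contraNneq uS => <-.
  have -> : #|S| = #|S :\ v :|: [set u]|.
    by rewrite setUC cardsU1 !inE (negPf uS) andbF (cardsD1 v S) vS.
  apply: leq_eps; last first.
    by apply: subset_trans (subsetUl _ _); rewrite subsetD1 AS.
  by rewrite Ind_del indu disjoint_sym disjoints1 !inE eqxx (negPf vu).
rewrite Ind_del => /andP[indS]; rewrite disjoint_sym disjoints_subset.
rewrite subUset sub1set inE => /andP[vS _].
have indvS : S \in Ind (del G [set v]).
  by rewrite Ind_del indS disjoint_sym disjoints1.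
have [M [indM SM] epsM] := eps_attained indvS.
move: indM; rewrite Ind_del disjoint_sym disjoints1 => /andP[indM vM].
have [dM|] := boolP [disjoint M & nbh G v].
  (* By [eps_eq] at [S], this bound becomes [#|M|.+1 <= #|M|]. *)
  have := leq_eps (IndU1 hv indM dM) (subset_trans SM (subsetUr _ _)).
  by rewrite -eps_eq // epsM cardsU1 vM ltnn.
(* Both [S] and [u] lie inside [M], so their union inherits independence. *)
case/pred0Pn=> u /andP[/= uM uv]; exists u => //.
by apply: Ind_subset indM; rewrite subUset SM sub1set.
Qed.
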